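(* Let $F$ be an Archimedean Riesz space. Then for every truncation $\tau$ on $F$, the induced truncation $\overline{\tau}$ on the quotient Riesz space $F/F_0(\tau)$ is Archimedean.
   Context: All Riesz spaces are real. A truncation on a Riesz space $F$ is a map $\tau : F^{+} \to F^{+}$ such that $\tau(f) \wedge g = f \wedge \tau(g)$ for all $f, g \in F^{+}$. It is Archimedean if, for $f \in F^{+}$, $\tau(nf) = nf$ for all $n \in \mathbb{N}$ implies $f = 0$. The set $$F_0(\tau) = \{ g \in F : \tau(n|g|) = n|g| \text{ for all } n \in \mathbb{N} \}$$ of truncation infinitesimal elements is a band of $F$. Let $q : F \to F/F_0(\tau)$ be the quotient Riesz homomorphism. The induced truncation $\overline{\tau}$ is the unique truncation on $F/F_0(\tau)$ satisfying $\overline{\tau}(q(g)) = q(\tau(g))$ for all $g \in F^{+}$ (it exists for every truncation $\tau$ on any Riesz space $F$). *)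

(* Defs.v *)
From HB Require Import structures.
From mathcomp Require Import all_boot all_order all_algebra generic_quotient ring_quotient.
From mathcomp Require Import boolp reals.

Set Implicit Arguments.
Unset Strict Implicit.
Unset Printing Implicit Defensive.

Import Order.TTheory GRing.Theory Num.Theory.

Local Open Scope ring_scope.
Local Open Scope quotient_scope.

(* The order of a Riesz space lives in [ring_display], so that its comparisons
   are those of [ring_scope]. Hierarchy Builder rejects a join of [lmodType]
   with [latticeType] declared after [realDomainType], so the lattice axioms are
   part of the mixin below and the [latticeType] instance is derived from them;
   meets and joins are then written [x `&` y] and [x `|` y] in [order_scope]. *)
HB.mixin Record isRiesz (R : realType) V
    of GRing.Lmodule R V & Order.POrder ring_display V := {
  riesz_meet : V -> V -> V;
  riesz_join : V -> V -> V;
  riesz_lexI : forall x y z : V,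
    (x <= riesz_meet y z) = (x <= y) && (x <= z);
  riesz_leUx : forall x y z : V,
    (riesz_join x y <= z) = (x <= z) && (y <= z);
  riesz_leD2r : forall z x y : V, x <= y -> x + z <= y + z;
  riesz_scale_ge0 : forall (a : R) (x : V), 0 <= a -> 0 <= x -> 0 <= a *: x
}.

#[short(type="rieszType")]
HB.structure Definition Riesz (R : realType) :=
  {V of GRing.Lmodule R V & Order.POrder ring_display V & isRiesz R V}.

#[non_forgetful_inheritance]
HB.instance Definition _ (R : realType) (F : rieszType R) :=
  Order.POrder_MeetJoin_isLattice.Build ring_display (@Riesz.sort R F)
    riesz_lexI riesz_leUx.

(* The notation [`|x|] is for normed structures. *)
Definition riesz_abs (R : realType) (F : rieszType R) (x : F) : F :=
  (x `|` - x)%O.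

Definition archimedean_riesz (R : realType) (F : rieszType R) : Prop :=
  forall f g : F, 0 <= f -> (forall n : nat, f *+ n <= g) -> f = 0.

Section RieszTheory.
Variables (R : realType) (F : rieszType R).
Implicit Types (x y z : F) (a : R).

Local Notation abs := (@riesz_abs R F).

Lemma riesz_le2r z x y : (x + z <= y + z) = (x <= y).
Proof.
apply/idP/idP; last exact: riesz_leD2r.
by move=> /(riesz_leD2r (- z)); rewrite !addrK.
Qed.

Lemma riesz_le2l z x y : (z + x <= z + y) = (x <= y).
Proof. by rewrite ![z + _]addrC riesz_le2r. Qed.

Lemma riesz_leD x y z t : x <= y -> z <= t -> x + z <= y + t.
Proof.
move=> xy zt; apply: (le_trans (y := y + z)).
  by rewrite riesz_le2r.
by rewrite riesz_le2l.
Qed.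

Lemma riesz_subr_ge0 x y : (0 <= y - x) = (x <= y).
Proof. by rewrite -(riesz_le2r x 0) add0r subrK. Qed.

Lemma riesz_leBlDr x y z : (x - y <= z) = (x <= z + y).
Proof. by rewrite -(riesz_le2r y (x - y)) subrK. Qed.

Lemma riesz_leN2 x y : (- x <= - y) = (y <= x).
Proof. by rewrite -(riesz_subr_ge0 (- x)) opprK addrC riesz_subr_ge0. Qed.

Lemma riesz_leNr x y : (x <= - y) = (y <= - x).
Proof. by rewrite -riesz_leN2 opprK. Qed.

Lemma riesz_addr_ge0 x y : 0 <= x -> 0 <= y -> 0 <= x + y.
Proof. by move=> x0 y0; rewrite -[0](addr0 0) riesz_leD. Qed.

Lemma riesz_mulrn_ge0 x n : 0 <= x -> 0 <= x *+ n.
Proof.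
move=> x0; elim: n => [|n IH]; first by rewrite mulr0n.
by rewrite mulrS riesz_addr_ge0.
Qed.

Lemma riesz_ler_wZ2l a x y : 0 <= a -> x <= y -> a *: x <= a *: y.
Proof.
move=> a0 xy; rewrite -riesz_subr_ge0 -scalerBr.
by apply: riesz_scale_ge0; rewrite // riesz_subr_ge0.
Qed.

Lemma riesz_ler_wZ2r a b x : a <= b -> 0 <= x -> a *: x <= b *: x.
Proof.
move=> ab x0; rewrite -riesz_subr_ge0 -scalerBl.
by apply: riesz_scale_ge0; rewrite // subr_ge0.
Qed.

Lemma riesz_ler_wMn2r n x y : x <= y -> x *+ n <= y *+ n.
Proof. by move=> xy; rewrite -!scaler_nat riesz_ler_wZ2l. Qed.

Lemma riesz_oppU x y : - (x `|` y)%O = (- x `&` - y)%O.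
Proof.
apply/le_anti/andP; split.
  by rewrite lexI !riesz_leN2 leUl leUr.
by rewrite riesz_leNr leUx; apply/andP; rewrite !(riesz_leNr _ (_ `&` _)%O) leIl leIr.
Qed.

Lemma riesz_oppI x y : - (x `&` y)%O = (- x `|` - y)%O.
Proof. by rewrite -[RHS]opprK riesz_oppU !opprK. Qed.

Lemma riesz_mulrnU n x y : ((x `|` y) *+ n)%O = (x *+ n `|` y *+ n)%O.
Proof.
case: n => [|n]; first by rewrite !mulr0n joinxx.
have n0 : 0 <= (n.+1%:R : R)^-1 by rewrite invr_ge0 ler0n.
have nK : (n.+1%:R : R) != 0 by rewrite pnatr_eq0.
apply/le_anti/andP; split; last first.
  by rewrite leUx !riesz_ler_wMn2r ?leUl ?leUr.
have up z : z *+ n.+1 <= (x *+ n.+1 `|` y *+ n.+1)%O ->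
    z <= n.+1%:R^-1 *: (x *+ n.+1 `|` y *+ n.+1)%O.
  by move=> /(riesz_ler_wZ2l n0); rewrite -{1}(scaler_nat n.+1) scalerK.
rewrite -[leLHS]scaler_nat -[leRHS](scalerKV nK) riesz_ler_wZ2l//.
by rewrite leUx !up// ?leUl ?leUr.
Qed.

Lemma riesz_absl x : x <= abs x. Proof. exact: leUl. Qed.
Lemma riesz_absr x : - x <= abs x. Proof. exact: leUr. Qed.

Lemma riesz_abs_le x y : (abs x <= y) = (x <= y) && (- x <= y).
Proof. exact: leUx. Qed.

Lemma riesz_absN x : abs (- x) = abs x.
Proof. by rewrite /riesz_abs opprK joinC. Qed.

Lemma riesz_abs_ge0 x : 0 <= abs x.
Proof.
have h : 0 <= abs x *+ 2.
  by rewrite -(subrr x) mulr2n riesz_leD ?riesz_absl ?riesz_absr.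
have e : abs x = 2%:R^-1 *: (abs x *+ 2).
  by rewrite -(scaler_nat 2) scalerK// pnatr_eq0.
by rewrite e riesz_scale_ge0// invr_ge0 ler0n.
Qed.

Lemma riesz_ge0_abs x : 0 <= x -> abs x = x.
Proof.
move=> x0; apply: join_l; apply: (le_trans (y := 0)) => //.
by rewrite -oppr0 riesz_leN2.
Qed.

Lemma riesz_absD x y : abs (x + y) <= abs x + abs y.
Proof.
by rewrite riesz_abs_le opprD !riesz_leD ?riesz_absl ?riesz_absr.
Qed.

Lemma riesz_absZ a x : abs (a *: x) <= `|a| *: abs x.
Proof.
rewrite riesz_abs_le; have [a0|/ltW a0] := leP 0 a.
  by rewrite ger0_norm// -scalerN !riesz_ler_wZ2l ?riesz_absl ?riesz_absr.
rewrite ler0_norm// -scaleNr -[a *: x]opprK -scaleNr -scalerN.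
by rewrite !riesz_ler_wZ2l ?riesz_absl ?riesz_absr ?oppr_ge0.
Qed.

Lemma riesz_abs_subI x y x' y' :
  abs ((x `&` y)%O - (x' `&` y')%O) <= abs (x - x') + abs (y - y').
Proof.
have half (u v u' v' : F) :
    (u `&` v)%O - (u' `&` v')%O <= abs (u - u') + abs (v - v').
  rewrite riesz_leBlDr addrC -riesz_leBlDr lexI !riesz_leBlDr.
  apply/andP; split; [apply: (le_trans (leIl _ _))|apply: (le_trans (leIr _ _))].
    rewrite addrC -riesz_leBlDr -[leLHS]addr0.
    by rewrite riesz_leD ?riesz_absl ?riesz_abs_ge0.
  rewrite addrC -riesz_leBlDr -[leLHS]add0r.
  by rewrite riesz_leD ?riesz_absl ?riesz_abs_ge0.
rewrite riesz_abs_le half opprB (le_trans (half _ _ _ _))//.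
by rewrite -(riesz_absN (x - x')) -(riesz_absN (y - y')) !opprB.
Qed.

End RieszTheory.

Record rieszIdeal (R : realType) (F : rieszType R) := RieszIdeal {
  ideal_pred :> {pred F};
  ideal_submod : subsemimod_closed ideal_pred;
  riesz_solid : forall f g : F,
    riesz_abs f <= riesz_abs g -> g \in ideal_pred -> f \in ideal_pred
}.

HB.instance Definition _ (R : realType) (F : rieszType R) (I : rieszIdeal F) :=
  GRing.isSubmodClosed.Build R F (ideal_pred I) (ideal_submod I).

Definition ideal_zmod (R : realType) (F : rieszType R) (I : rieszIdeal F)
  : zmodClosed F := GRing.ZmodClosed.clone F (ideal_pred I) _.

Definition riesz_quot (R : realType) (F : rieszType R) (I : rieszIdeal F)
  : Type := Quotient.quot (ideal_zmod I).

(* The canonical map F -> F / I. *)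
Definition riesz_pi (R : realType) (F : rieszType R) (I : rieszIdeal F)
  (f : F) : riesz_quot I := \pi_(Quotient.quot (ideal_zmod I)) f.

HB.instance Definition _ (R : realType) (F : rieszType R) (I : rieszIdeal F) :=
  GRing.Zmodule.copy (riesz_quot I) (Quotient.quot (ideal_zmod I)).

Section RieszQuotient.
Variables (R : realType) (F : rieszType R) (I : rieszIdeal F).
Implicit Types (f g h : F) (x y z : riesz_quot I) (a : R).

Local Notation Q := (riesz_quot I).
Local Notation q := (@riesz_pi R F I).
Local Notation abs := (@riesz_abs R F).

Definition riesz_repr x : F := repr (x : Quotient.quot (ideal_zmod I)).

Lemma riesz_reprK : cancel riesz_repr q.
Proof. by move=> x; rewrite /riesz_pi reprK. Qed.

Lemma riesz_pi_eq f g : (q f = q g) <-> (f - g \in I).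
Proof.
rewrite /riesz_pi Quotient.idealrBE; split; first by move=> ->.
by move/eqP.
Qed.

Lemma riesz_piD : {morph q : f g / f + g}.
Proof. by move=> f g; exact: Quotient.pi_add. Qed.

Lemma riesz_piN : {morph q : f / - f}.
Proof. by move=> f; exact: Quotient.pi_opp. Qed.

Lemma riesz_pi0 : q 0 = 0.
Proof. by rewrite -(subrr 0) riesz_piD riesz_piN subrr. Qed.

Lemma riesz_ideal_abs f : (abs f \in I) = (f \in I).
Proof.
have e : abs (abs f) = abs f by apply: riesz_ge0_abs; exact: riesz_abs_ge0.
by apply/idP/idP; apply: riesz_solid; rewrite e.
Qed.

Lemma riesz_ideal_le f g : abs f <= g -> g \in I -> f \in I.
Proof.
by move=> fg; apply: riesz_solid; apply: (le_trans fg); exact: riesz_absl.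
Qed.

Definition quot_scale a x : Q := q (a *: riesz_repr x).

Lemma quot_scaleE a f : quot_scale a (q f) = q (a *: f).
Proof.
apply/riesz_pi_eq; rewrite -scalerBr rpredZ//.
by apply/riesz_pi_eq; rewrite riesz_reprK.
Qed.

Lemma quot_scalerA a b x : quot_scale a (quot_scale b x) = quot_scale (a * b) x.
Proof. by rewrite -[x]riesz_reprK !quot_scaleE scalerA. Qed.

Lemma quot_scale1r : left_id 1 quot_scale.
Proof. by move=> x; rewrite -[x]riesz_reprK quot_scaleE scale1r. Qed.

Lemma quot_scalerDr : right_distributive quot_scale +%R.
Proof.
move=> a x y; rewrite -[x]riesz_reprK -[y]riesz_reprK.
by rewrite -riesz_piD !quot_scaleE -riesz_piD scalerDr.
Qed.

Lemma quot_scalerDl x : {morph quot_scale^~ x : a b / a + b}.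
Proof.
by move=> a b; rewrite -[x]riesz_reprK !quot_scaleE -riesz_piD scalerDl.
Qed.

HB.instance Definition _ := GRing.Zmodule_isLmodule.Build R Q
  quot_scalerA quot_scale1r quot_scalerDr quot_scalerDl.

Definition quot_le x y : bool :=
  `[< exists f g, [/\ q f = x, q g = y & f <= g] >].

Lemma quot_leE f g : quot_le (q f) (q g) <-> exists2 i, i \in I & f <= g + i.
Proof.
split.
  move=> /asboolP[f' [g' [/riesz_pi_eq ff' /riesz_pi_eq gg' fg']]].
  exists ((g' - g) - (f' - f)); first by rewrite rpredB.
  by rewrite opprB addrA [g + _]addrC subrK -[leLHS](subrKC f') riesz_le2r.
move=> [i iI fgi]; apply/asboolP; exists f, (g + i); split => //.
by apply/riesz_pi_eq; rewrite addrAC subrr add0r.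
Qed.

Lemma quot_le_refl : reflexive quot_le.
Proof. by move=> x; apply/asboolP; exists (riesz_repr x), (riesz_repr x); rewrite riesz_reprK. Qed.

Lemma quot_le_anti : antisymmetric quot_le.
Proof.
move=> x y; rewrite -[x]riesz_reprK -[y]riesz_reprK.
set f := riesz_repr x; set g := riesz_repr y.
move=> /andP[/quot_leE[i iI fgi] /quot_leE[j jI gfj]].
apply/riesz_pi_eq; apply: (@riesz_ideal_le _ (abs i + abs j)); last first.
  by rewrite rpredD// riesz_ideal_abs.
rewrite riesz_abs_le opprB; apply/andP; split.
  rewrite riesz_leBlDr addrC (le_trans fgi)// riesz_le2l -[leLHS]addr0.
  by rewrite riesz_leD ?riesz_absl ?riesz_abs_ge0.
rewrite riesz_leBlDr addrC (le_trans gfj)// riesz_le2l -[leLHS]add0r.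
by rewrite riesz_leD ?riesz_absl ?riesz_abs_ge0.
Qed.

Lemma quot_le_trans : transitive quot_le.
Proof.
move=> y x z; rewrite -[x]riesz_reprK -[y]riesz_reprK -[z]riesz_reprK.
move=> /quot_leE[i iI fgi] /quot_leE[j jI gfj].
apply/quot_leE; exists (j + i); first by rewrite rpredD.
by rewrite (le_trans fgi)// addrA riesz_le2r.
Qed.

HB.instance Definition _ := Order.Le_isPOrder.Build ring_display Q
  quot_le_refl quot_le_anti quot_le_trans.

Definition quot_meet x y : Q := q (riesz_repr x `&` riesz_repr y)%O.
Definition quot_join x y : Q := q (riesz_repr x `|` riesz_repr y)%O.

Lemma riesz_pi_le f g : f <= g -> q f <= q g.
Proof. by move=> fg; apply/asboolP; exists f, g. Qed.

Lemma riesz_piI0 f g : quot_meet (q f) (q g) = q (f `&` g)%O.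
Proof.
apply/riesz_pi_eq; apply: (riesz_ideal_le (riesz_abs_subI _ _ _ _)).
by rewrite rpredD// riesz_ideal_abs; apply/riesz_pi_eq; rewrite riesz_reprK.
Qed.

Lemma quot_meetP x y z : (x <= quot_meet y z) = (x <= y) && (x <= z).
Proof.
rewrite -[x]riesz_reprK -[y]riesz_reprK -[z]riesz_reprK riesz_piI0.
set f := riesz_repr x; set g := riesz_repr y; set h := riesz_repr z.
apply/idP/andP => [fgh|[/quot_leE[i iI fi] /quot_leE[j jI fj]]].
  by split; apply: (le_trans fgh); apply: riesz_pi_le; rewrite ?leIl ?leIr.
apply/quot_leE; exists (abs i + abs j); first by rewrite rpredD// riesz_ideal_abs.
rewrite -riesz_leBlDr lexI !riesz_leBlDr; apply/andP; split.
  rewrite (le_trans fi)// riesz_le2l -[leLHS]addr0.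
  by rewrite riesz_leD ?riesz_absl ?riesz_abs_ge0.
rewrite (le_trans fj)// riesz_le2l -[leLHS]add0r.
by rewrite riesz_leD ?riesz_absl ?riesz_abs_ge0.
Qed.

Lemma quot_leN2 x y : (- x <= - y) = (y <= x).
Proof.
rewrite -[x]riesz_reprK -[y]riesz_reprK -!riesz_piN.
have aux f g : q f <= q g -> q (- g) <= q (- f).
  move=> /quot_leE[i iI fgi]; apply/quot_leE; exists i => //.
  by rewrite -riesz_leN2 opprD !opprK riesz_leBlDr.
by apply/idP/idP => /aux; rewrite ?opprK.
Qed.

Lemma quot_joinE x y : quot_join x y = - quot_meet (- x) (- y).
Proof.
rewrite -[x in RHS]riesz_reprK -[y in RHS]riesz_reprK.
rewrite -(riesz_piN (riesz_repr x)) -(riesz_piN (riesz_repr y)) riesz_piI0.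
by rewrite -riesz_piN riesz_oppI !opprK.
Qed.

Lemma quot_joinP x y z : (quot_join x y <= z) = (x <= z) && (y <= z).
Proof.
by rewrite quot_joinE -[z]opprK quot_leN2 quot_meetP !quot_leN2 opprK.
Qed.

Lemma quot_leD2r z x y : x <= y -> x + z <= y + z.
Proof.
rewrite -[x]riesz_reprK -[y]riesz_reprK -[z]riesz_reprK -!riesz_piD.
move=> /quot_leE[i iI h]; apply/quot_leE; exists i => //.
by rewrite addrAC riesz_le2r.
Qed.

Lemma quot_scale_ge0 a x : 0 <= a -> 0 <= x -> 0 <= a *: x.
Proof.
move=> a0; rewrite -[x]riesz_reprK -riesz_pi0 => /quot_leE[i iI h].
rewrite [_ *: _]quot_scaleE; apply/quot_leE; exists (a *: i).
  exact: rpredZ.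
by rewrite -scalerDr riesz_scale_ge0.
Qed.

HB.instance Definition _ := isRiesz.Build R Q
  quot_meetP quot_joinP quot_leD2r quot_scale_ge0.
HB.instance Definition _ := Order.Lattice.copy Q (Riesz.sort Q).

Lemma riesz_piZ a : {morph q : f / a *: f}.
Proof. by move=> f; rewrite -quot_scaleE. Qed.

Lemma riesz_piI : {morph q : f g / (f `&` g)%O}.
Proof. by move=> f g; rewrite -riesz_piI0. Qed.

Lemma riesz_piU : {morph q : f g / (f `|` g)%O}.
Proof.
move=> f g; rewrite -[(f `|` g)%O]opprK riesz_oppU riesz_piN riesz_piI.
by rewrite riesz_oppI !riesz_piN !opprK.
Qed.

Lemma riesz_pi_ker f : q f = 0 <-> f \in I.
Proof. by rewrite -riesz_pi0 riesz_pi_eq subr0. Qed.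

End RieszQuotient.

(* A map F^+ -> F^+ is represented by a map F -> F that preserves F^+; its
   values outside of F^+ are irrelevant. *)
Record truncation (R : realType) (F : rieszType R) := Truncation {
  trunc :> F -> F;
  trunc_ge0 : forall f : F, 0 <= f -> 0 <= trunc f;
  truncP : forall f g : F, 0 <= f -> 0 <= g ->
    (trunc f `&` g)%O = (f `&` trunc g)%O
}.

Definition archimedean_truncation (R : realType) (F : rieszType R)
    (tau : truncation F) : Prop :=
  forall f : F, 0 <= f -> (forall n : nat, tau (f *+ n) = f *+ n) -> f = 0.

Section TruncationTheory.
Variables (R : realType) (F : rieszType R) (tau : truncation F).
Implicit Types (f g h : F) (a : R).

Local Notation abs := (@riesz_abs R F).
(* F_0(tau) *)
Definition trunc_inf_pred : F -> bool :=
  fun g => `[< forall n : nat, tau (abs g *+ n) = abs g *+ n >].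

Local Notation F0 := trunc_inf_pred.

Lemma trunc_le f : 0 <= f -> tau f <= f.
Proof.
move=> f0; have t0 := trunc_ge0 tau f0.
by have := truncP tau f0 t0; rewrite meetxx => ->; exact: leIl.
Qed.

Lemma trunc_fix_le f g : 0 <= g -> g <= f -> tau f = f -> tau g = g.
Proof.
move=> g0 gf tf; have f0 := le_trans g0 gf.
have tgf : tau g <= f by rewrite (le_trans (trunc_le g0)).
by have := truncP tau f0 g0; rewrite tf (meet_r gf) (meet_r tgf).
Qed.

Lemma trunc_fix_join f g : 0 <= f -> 0 <= g ->
  tau f = f -> tau g = g -> tau (f `|` g)%O = (f `|` g)%O.
Proof.
move=> f0 g0 tf tg; have h0 : 0 <= (f `|` g)%O by rewrite (le_trans f0)// leUl.
apply/le_anti; rewrite trunc_le//= leUx; apply/andP; split.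
  by have := truncP tau h0 f0; rewrite tf (meet_r (leUl _ _)) => e; rewrite -[leLHS]e leIl.
by have := truncP tau h0 g0; rewrite tg (meet_r (leUr _ _)) => e; rewrite -[leLHS]e leIl.
Qed.

Lemma trunc_infP g :
  reflect (forall n : nat, tau (abs g *+ n) = abs g *+ n) (g \in F0).
Proof. exact: asboolP. Qed.

Lemma trunc_inf_solid f g : abs f <= abs g -> g \in F0 -> f \in F0.
Proof.
move=> fg /trunc_infP gF; apply/trunc_infP => n.
apply: trunc_fix_le (gF n); first by rewrite riesz_mulrn_ge0// riesz_abs_ge0.
exact: riesz_ler_wMn2r.
Qed.

Lemma trunc_inf0 : 0 \in F0.
Proof.
apply/trunc_infP => n; rewrite riesz_ge0_abs// mul0rn.
by apply/le_anti; rewrite trunc_le//= trunc_ge0.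
Qed.

Lemma trunc_infZ a f : f \in F0 -> a *: f \in F0.
Proof.
move=> fF; have [m /ltW am] : exists m : nat, `|a| < m%:R.
  by exists (Num.truncn `|a|).+1; exact: truncnS_gt.
apply/trunc_infP => n; move/trunc_infP: fF => /(_ (m * n)%N).
apply: trunc_fix_le; first by rewrite riesz_mulrn_ge0// riesz_abs_ge0.
rewrite mulrnA; apply: riesz_ler_wMn2r; apply: (le_trans (riesz_absZ _ _)).
by rewrite -scaler_nat riesz_ler_wZ2r// riesz_abs_ge0.
Qed.

Lemma trunc_infD f g : f \in F0 -> g \in F0 -> f + g \in F0.
Proof.
move=> /trunc_infP fF /trunc_infP gF; apply/trunc_infP => n.
have [f0 g0] := (riesz_abs_ge0 f, riesz_abs_ge0 g).
have := @trunc_fix_join _ _ (riesz_mulrn_ge0 (2 * n) f0)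
  (riesz_mulrn_ge0 (2 * n) g0) (fF _) (gF _).
rewrite -riesz_mulrnU mulrnA; apply: trunc_fix_le.
  by rewrite riesz_mulrn_ge0// riesz_abs_ge0.
apply: riesz_ler_wMn2r; apply: (le_trans (riesz_absD _ _)).
by rewrite mulr2n riesz_leD// ?leUl ?leUr.
Qed.

Lemma trunc_inf_submod : subsemimod_closed F0.
Proof.
split; first by split; [exact: trunc_inf0|exact: trunc_infD].
by move=> a f; exact: trunc_infZ.
Qed.

Definition trunc_infinitesimal : rieszIdeal F :=
  RieszIdeal trunc_inf_submod trunc_inf_solid.

Lemma trunc_mono f g : 0 <= f -> f <= g -> tau f <= tau g.
Proof.
move=> f0 fg; have g0 := le_trans f0 fg.
have tfg : tau f <= g by rewrite (le_trans (trunc_le f0)).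
by have := truncP tau g0 f0; rewrite (meet_r tfg) => e; rewrite -[leLHS]e leIl.
Qed.

End TruncationTheory.

(* F / F_0(tau) *)
Definition trunc_quot (R : realType) (F : rieszType R) (tau : truncation F)
  : rieszType R := riesz_quot (trunc_infinitesimal tau).

Definition trunc_pi (R : realType) (F : rieszType R) (tau : truncation F)
  : F -> trunc_quot tau := @riesz_pi R F (trunc_infinitesimal tau).

Section InducedTruncation.
Variables (R : realType) (F : rieszType R) (tau : truncation F).
Implicit Types (f g : F) (x y : trunc_quot tau).

Local Notation q := (@trunc_pi R F tau).
Local Notation abs := (@riesz_abs R F).

(* [pos_repr x] is a representative of [x] in F^+ when 0 <= x. *)
Definition pos_repr x : F := (@riesz_repr R F (trunc_infinitesimal tau) x `|` 0)%O.

Lemma pos_repr_ge0 x : 0 <= pos_repr x.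
Proof. exact: leUr. Qed.

Lemma pos_reprK x : 0 <= x -> q (pos_repr x) = x.
Proof.
move=> x0; rewrite /trunc_pi /pos_repr riesz_piU riesz_reprK riesz_pi0.
exact: join_l.
Qed.

Lemma trunc_pi_trunc f g : 0 <= f -> 0 <= g -> q f = q g -> q (tau f) = q (tau g).
Proof.
move=> f0 g0 fg.
have half (h k : F) : 0 <= h -> 0 <= k -> tau h - tau k <= abs (h - k).
  move=> h0 k0; have hk0 : 0 <= (h `|` k)%O by rewrite (le_trans h0)// leUl.
  apply: (le_trans (y := tau (h `|` k)%O - tau k)).
    by rewrite riesz_le2r trunc_mono// leUl.
  rewrite riesz_leBlDr.
  have e : (tau (h `|` k)%O `&` k)%O = tau k.
    rewrite truncP// meet_r// (le_trans (trunc_le tau k0))// leUr//.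
  have le_hk : (h `|` k)%O <= abs (h - k) + k.
    rewrite leUx -riesz_leBlDr riesz_absl /=.
    by rewrite -[leLHS]add0r riesz_le2r riesz_abs_ge0.
  set t := tau _; rewrite -/t in e.
  have tD : t <= abs (h - k) + t by rewrite -[leLHS]add0r riesz_le2r riesz_abs_ge0.
  have tk : t <= abs (h - k) + k by rewrite (le_trans _ le_hk)// trunc_le.
  by rewrite -e addrC -riesz_leBlDr lexI !riesz_leBlDr ![_ + abs _]addrC tD.
apply/riesz_pi_eq; move/riesz_pi_eq: fg => fg.
apply: (@riesz_ideal_le R F _ _ (abs (f - g))); last by rewrite riesz_ideal_abs.
by rewrite riesz_abs_le half//= opprB -(riesz_absN (f - g)) opprB half.
Qed.

Definition induced_trunc x : trunc_quot tau := q (tau (pos_repr x)).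

Lemma induced_trunc_ge0 x : 0 <= x -> 0 <= induced_trunc x.
Proof.
move=> _; rewrite -[0](@riesz_pi0 R F (trunc_infinitesimal tau)).
by apply: riesz_pi_le; rewrite trunc_ge0// pos_repr_ge0.
Qed.

Lemma induced_truncP x y : 0 <= x -> 0 <= y ->
  (induced_trunc x `&` y)%O = (x `&` induced_trunc y)%O.
Proof.
move=> x0 y0; rewrite /induced_trunc.
rewrite -[y in LHS](pos_reprK y0) -[x in RHS](pos_reprK x0).
rewrite /trunc_pi -!riesz_piI.
by rewrite truncP ?pos_repr_ge0.
Qed.

Definition induced_truncation : truncation (trunc_quot tau) :=
  Truncation induced_trunc_ge0 induced_truncP.

Lemma induced_truncationE f : 0 <= f -> induced_truncation (q f) = q (tau f).
Proof.
move=> f0; apply: trunc_pi_trunc => //; first exact: pos_repr_ge0.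
rewrite pos_reprK// -[0](@riesz_pi0 R F (trunc_infinitesimal tau)).
exact: riesz_pi_le.
Qed.

Lemma induced_truncation_unique (sigma : truncation (trunc_quot tau)) :
  (forall f, 0 <= f -> sigma (q f) = q (tau f)) ->
  forall x, 0 <= x -> sigma x = induced_truncation x.
Proof.
move=> h x x0; rewrite -(pos_reprK x0) h ?pos_repr_ge0//.
by rewrite induced_truncationE// pos_repr_ge0.
Qed.

End InducedTruncation.

(* Main.v *)
Require Import Defs.
From mathcomp Require Import all_boot all_order all_algebra.
From mathcomp Require Import reals.

Import Order.TTheory GRing.Theory.

Local Open Scope ring_scope.

(** Let [q] be the projection onto F / F_0(tau). If the induced truncation
    fixes every multiple of [q f], with [f >= 0], then each defect
    [n f - tau (n f)] is truncation infinitesimal. The point is that in an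
    Archimedean space such a defect always vanishes
    ([trunc_fix_of_infinitesimal_defect]): the defect [g] of a positive [h] lies
    below [h], and since [tau] is monotone and fixes all multiples of [g], these
    multiples are pushed, one after the other, below [tau h]
    ([infinitesimal_defect_bounded]). A positive element with bounded multiples
    is zero, so [tau h = h]. Hence [tau] fixes all the multiples of [f] itself,
    i.e. [q f = 0]. *)

(** By induction, with [g := f - tau f]: if [g *+ n <= tau f], then
    [g *+ n.+1 <= tau f + g = f]; applying the monotone map [tau], which fixes
    [g *+ n.+1], gives back [g *+ n.+1 <= tau f]. *)
Lemma infinitesimal_defect_bounded (R : realType) (F : rieszType R)
    (tau : truncation F) (f : F) :
  0 <= f -> f - tau f \in trunc_infinitesimal tau ->
  forall n : nat, (f - tau f) *+ n <= tau f.
Proof.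
move=> f0 /trunc_infP gF; set g := f - tau f in gF *.
have g0 : 0 <= g by rewrite riesz_subr_ge0 trunc_le.
elim=> [|n IHn]; first by rewrite mulr0n trunc_ge0.
have <- : tau (g *+ n.+1) = g *+ n.+1.
  by have := gF n.+1; rewrite riesz_ge0_abs.
apply: trunc_mono; first exact: riesz_mulrn_ge0.
by rewrite mulrS -[leRHS](subrK (tau f) f) riesz_le2l.
Qed.

Lemma trunc_fix_of_infinitesimal_defect (R : realType) (F : rieszType R)
    (tau : truncation F) (f : F) :
  archimedean_riesz F -> 0 <= f ->
  f - tau f \in trunc_infinitesimal tau -> tau f = f.
Proof.
move=> hF f0 gF; apply/esym/eqP; rewrite -subr_eq0; apply/eqP.
apply: hF (@infinitesimal_defect_bounded _ _ _ _ f0 gF).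
by rewrite riesz_subr_ge0 trunc_le.
Qed.

Theorem theorem3p20 (R : realType) (F : rieszType R)
    (hF : archimedean_riesz F) (tau : truncation F) :
  archimedean_truncation (induced_truncation tau).
Proof.
move=> x x0 xfix.
have [f f0 qf] : exists2 f, 0 <= f & trunc_pi tau f = x.
  by exists (pos_repr x); [exact: pos_repr_ge0|exact: pos_reprK].
have qMn n : trunc_pi tau (f *+ n) = x *+ n.
  elim: n => [|n IHn]; first by rewrite !mulr0n; exact: riesz_pi0.
  by rewrite !mulrS -IHn -qf; exact: riesz_piD.
rewrite -qf; apply/riesz_pi_ker/trunc_infP => n; rewrite riesz_ge0_abs//.
have fn0 : 0 <= f *+ n by exact: riesz_mulrn_ge0.
apply: trunc_fix_of_infinitesimal_defect => //.
apply/riesz_pi_eq/esym.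
by have := xfix n; rewrite -qMn induced_truncationE.
Qed.
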